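(* Let $R$ be an integral domain containing $\mathbb{Z}$ as a subring. Let $X$ be a finite set and $G$ an undirected graph without loops with vertex set $X$. Suppose that there exists $x\in X$ whose $\sim_{\perp}$-equivalence class $\widetilde{X}^{\perp}_x$ has more than one element. Let $X'=X\backslash\{x\}$ and let $G'=G(X')$ be the subgraph of $G$ induced on $X'$. Then the partially commutative metabelian Lie $R$-algebras $M(X;G)$ and $M(X';G')$ are universally equivalent.
   Context: For a finite undirected graph $G$ without loops and with vertex set $X$, the partially commutative metabelian Lie $R$-algebra $M(X;G)$ is the quotient of the free metabelian Lie $R$-algebra on the generating set $X$ by the ideal generated by all $[x,y]$ with $\{x,y\}$ an edge of $G$. (Metabelian: $[[a,b],[c,d]]=0$ for all $a,b,c,d$.) For a vertex $x$ of $G$ put $x^{\perp}=\{y\in X\mid d(x,y)\leqslant 1\}$, where $d$ is the graph distance in $G$ (so $x^\perp$ consists of $x$ and its neighbours). The equivalence relation $\sim_{\perp}$ on $X$ is defined by $x\sim_{\perp}y$ iff $x^{\perp}=y^{\perp}$, and $\widetilde{X}^{\perp}_x$ is the $\sim_\perp$-class of $x$. Two Lie algebras are universally equivalent if they satisfy the same universal sentences, i.e. sentences without free variables of the form $\forall w_1\dots w_k\,\Phi(w_1,\dots,w_k)$ with $\Phi$ quantifier-free, in the first-order language with equality, addition $+$, Lie bracket $[\cdot,\cdot]$ and $0$ (equivalently, if they satisfy the same existential sentences). *)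

(* Defs.v *)
From HB Require Import structures.
From mathcomp Require Import all_boot all_order all_algebra generic_quotient.
From mathcomp Require Import boolp.

Set Implicit Arguments.
Unset Strict Implicit.
Unset Printing Implicit Defensive.

Import GRing.Theory.
Local Open Scope ring_scope.
Local Open Scope quotient_scope.

(** * Lie algebras *)

HB.mixin Record isLieAlgebra (R : comNzRingType) L of GRing.Lmodule R L := {
  bracket : L -> L -> L;
  bracket_linearl : forall v, linear (bracket^~ v);
  bracket_linearr : forall u, linear (bracket u);
  bracketvv : forall u, bracket u u = 0;
  jacobi : forall u v w,
    bracket u (bracket v w) + bracket v (bracket w u)
      + bracket w (bracket u v) = 0
}.

#[short(type="lieAlgType")]
HB.structure Definition LieAlgebra (R : comNzRingType) :=
  {L of isLieAlgebra R L & GRing.Lmodule R L}.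

Definition lie_morphism (R : comNzRingType) (L L' : lieAlgType R)
    (f : L -> L') : Prop :=
  linear f /\ forall u v, f (bracket u v) = bracket (f u) (f v).

Definition metabelian (R : comNzRingType) (L : lieAlgType R) : Prop :=
  forall a b c d : L, bracket (bracket a b) (bracket c d) = 0.

(** * Quotient by the ideal generated by a set *)

Definition lie_ideal (R : comNzRingType) (L : lieAlgType R) (I : L -> Prop) :
    Prop :=
  [/\ I 0,
      forall (a : R) u v, I u -> I v -> I (a *: u + v)
    & forall u v, I v -> I (bracket u v)].

Definition ideal_gen (R : comNzRingType) (L : lieAlgType R) (S : L -> Prop) :
    {pred L} :=
  fun v => `[< forall I : L -> Prop,
                 lie_ideal I -> (forall u, S u -> I u) -> I v >].

Section LieQuotient.
Variables (R : comNzRingType) (L : lieAlgType R) (S : L -> Prop).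

Let J := @ideal_gen R L S.

Lemma ideal_gen_lin (a : R) u v : u \in J -> v \in J -> a *: u + v \in J.
Proof.
move=> /asboolP Ju /asboolP Jv; apply/asboolP => I idI SI.
by case: (idI) => _ Ilin _; apply: Ilin; [exact: Ju | exact: Jv].
Qed.

Lemma ideal_gen0 : 0 \in J.
Proof. by apply/asboolP => I []. Qed.

Lemma ideal_gen_bracketr u v : v \in J -> bracket u v \in J.
Proof.
move=> /asboolP Jv; apply/asboolP => I idI SI.
by case: (idI) => _ _; apply; exact: Jv.
Qed.

Lemma bracketC (u v : L) : bracket u v = - bracket v u.
Proof.
apply/eqP; rewrite -addr_eq0; apply/eqP.
have := bracketvv (u + v).
have := bracket_linearl (u + v) 1 u v; rewrite /= !scale1r => ->.
have := bracket_linearr u 1 u v; rewrite /= !scale1r => ->.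
have := bracket_linearr v 1 u v; rewrite /= !scale1r => ->.
by rewrite !bracketvv add0r addr0.
Qed.

Lemma ideal_gen_submod_closed : submod_closed J.
Proof. by split=> [|a u v]; [exact: ideal_gen0 | exact: ideal_gen_lin]. Qed.

HB.instance Definition _ :=
  GRing.isSubmodClosed.Build R L (ideal_gen S) ideal_gen_submod_closed.

Lemma ideal_gen_bracketl u v : u \in J -> bracket u v \in J.
Proof. by move=> Ju; rewrite bracketC rpredN; exact: ideal_gen_bracketr. Qed.

Lemma ideal_gen_sub u : S u -> u \in J.
Proof. by move=> Su; apply/asboolP => I _; exact. Qed.

Definition lie_quot : Type := {ideal_quot (ideal_gen S)}.
HB.instance Definition _ := GRing.Zmodule.on lie_quot.
HB.instance Definition _ := EqQuotient.on lie_quot.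

Lemma lie_quot_eqP (u v : L) :
  reflect (\pi_lie_quot u = \pi_lie_quot v) (u - v \in J).
Proof.
by rewrite /J (Quotient.idealrBE (ideal_gen S)); exact: eqP.
Qed.

Definition lie_quot_scale (a : R) (u : lie_quot) : lie_quot :=
  \pi_lie_quot (a *: repr u).
Definition lie_quot_bracket (u v : lie_quot) : lie_quot :=
  \pi_lie_quot (bracket (repr u) (repr v)).

Lemma lie_quotD (u v : L) :
  \pi_lie_quot (u + v) = \pi_lie_quot u + \pi_lie_quot v.
Proof. by rewrite /lie_quot !piE. Qed.

Lemma lie_quot0 : \pi_lie_quot 0 = 0 :> lie_quot.
Proof. by rewrite /lie_quot !piE. Qed.

Lemma lie_quot_repr (u : L) : repr (\pi_lie_quot u) - u \in J.
Proof. by apply/lie_quot_eqP; rewrite reprK. Qed.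

Lemma lie_quot_scaleE (a : R) (u : L) :
  lie_quot_scale a (\pi_lie_quot u) = \pi_lie_quot (a *: u).
Proof.
apply/lie_quot_eqP; rewrite -scalerBr.
by rewrite -[_ *: _]addr0 ideal_gen_lin ?ideal_gen0 ?lie_quot_repr.
Qed.

Lemma lie_quot_bracketE (u v : L) :
  lie_quot_bracket (\pi_lie_quot u) (\pi_lie_quot v)
    = \pi_lie_quot (bracket u v).
Proof.
apply/lie_quot_eqP; set u' := repr _; set v' := repr _.
have -> : bracket u' v' - bracket u v
        = bracket (u' - u) v' + bracket u (v' - v).
  have := bracket_linearl v' (-1) u u'; rewrite /= !scaleN1r [- u + _]addrC => ->.
  have := bracket_linearr u (-1) v v'; rewrite /= !scaleN1r [- v + _]addrC => ->.
  by rewrite [RHS]addrC addrA addrK addrC.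
rewrite rpredD //.
  by apply: ideal_gen_bracketl; exact: lie_quot_repr.
by apply: ideal_gen_bracketr; exact: lie_quot_repr.
Qed.

Fact lie_quot_scaleA a b u :
  lie_quot_scale a (lie_quot_scale b u) = lie_quot_scale (a * b) u.
Proof.
elim/quotW: u => u.
by rewrite (lie_quot_scaleE b u) !lie_quot_scaleE scalerA.
Qed.
Fact lie_quot_scale1 : left_id 1 lie_quot_scale.
Proof. by elim/quotW => u; rewrite lie_quot_scaleE scale1r. Qed.
Fact lie_quot_scaleDr : right_distributive lie_quot_scale +%R.
Proof.
move=> a; elim/quotW => u; elim/quotW => v.
by rewrite -lie_quotD !lie_quot_scaleE -lie_quotD scalerDr.
Qed.
Fact lie_quot_scaleDl v : {morph lie_quot_scale^~ v : a b / a + b}.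
Proof.
by elim/quotW: v => v a b; rewrite !lie_quot_scaleE -lie_quotD scalerDl.
Qed.

HB.instance Definition _ := GRing.Zmodule_isLmodule.Build R lie_quot
  lie_quot_scaleA lie_quot_scale1 lie_quot_scaleDr lie_quot_scaleDl.

Lemma lie_quotZ (a : R) (u : L) :
  \pi_lie_quot (a *: u) = a *: \pi_lie_quot u.
Proof. by rewrite -lie_quot_scaleE. Qed.

Fact lie_quot_linearl v : linear (lie_quot_bracket^~ v).
Proof.
elim/quotW: v => v a; elim/quotW => u1; elim/quotW => u2.
rewrite -lie_quotZ -lie_quotD !lie_quot_bracketE.
by rewrite (bracket_linearl v) lie_quotD lie_quotZ.
Qed.
Fact lie_quot_linearr u : linear (lie_quot_bracket u).
Proof.
elim/quotW: u => u a; elim/quotW => v1; elim/quotW => v2.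
rewrite -lie_quotZ -lie_quotD !lie_quot_bracketE.
by rewrite (bracket_linearr u) lie_quotD lie_quotZ.
Qed.
Fact lie_quot_bracketvv u : lie_quot_bracket u u = 0.
Proof.
by elim/quotW: u => u; rewrite lie_quot_bracketE bracketvv lie_quot0.
Qed.
Fact lie_quot_jacobi u v w :
  lie_quot_bracket u (lie_quot_bracket v w)
    + lie_quot_bracket v (lie_quot_bracket w u)
    + lie_quot_bracket w (lie_quot_bracket u v) = 0.
Proof.
elim/quotW: u => u; elim/quotW: v => v; elim/quotW: w => w.
rewrite (lie_quot_bracketE v w) (lie_quot_bracketE w u) (lie_quot_bracketE u v).
by rewrite !lie_quot_bracketE -!lie_quotD jacobi lie_quot0.
Qed.

HB.instance Definition _ := isLieAlgebra.Build R lie_quot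
  lie_quot_linearl lie_quot_linearr lie_quot_bracketvv lie_quot_jacobi.

Lemma lie_quot_pi_morphism : lie_morphism (\pi_lie_quot : L -> lie_quot).
Proof.
by split=> [a u v|u v]; [rewrite lie_quotD lie_quotZ | rewrite -lie_quot_bracketE].
Qed.

End LieQuotient.

(** * The free metabelian Lie algebra

  It is the absolutely free algebra of terms over [X] in the signature of
  R-Lie algebras, modulo the least congruence containing the laws of modules,
  of Lie algebras, and the metabelian law. *)

Inductive fterm (R : comNzRingType) (X : Type) : Type :=
| FGen of X
| FZero
| FOpp of fterm R X
| FAdd of fterm R X & fterm R X
| FScale of R & fterm R X
| FBracket of fterm R X & fterm R X.

Arguments FGen R {X}.
Arguments FZero {R X}.

Inductive fterm_eq (R : comNzRingType) (X : Type) :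
    fterm R X -> fterm R X -> Prop :=
| fe_refl s : fterm_eq s s
| fe_sym s t : fterm_eq s t -> fterm_eq t s
| fe_trans s t r : fterm_eq s t -> fterm_eq t r -> fterm_eq s r
| fe_opp s s' : fterm_eq s s' -> fterm_eq (FOpp s) (FOpp s')
| fe_add s s' t t' : fterm_eq s s' -> fterm_eq t t' ->
    fterm_eq (FAdd s t) (FAdd s' t')
| fe_scale a s s' : fterm_eq s s' -> fterm_eq (FScale a s) (FScale a s')
| fe_bracket s s' t t' : fterm_eq s s' -> fterm_eq t t' ->
    fterm_eq (FBracket s t) (FBracket s' t')
| fe_addA s t r : fterm_eq (FAdd s (FAdd t r)) (FAdd (FAdd s t) r)
| fe_addC s t : fterm_eq (FAdd s t) (FAdd t s)
| fe_add0 s : fterm_eq (FAdd FZero s) s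
| fe_addN s : fterm_eq (FAdd (FOpp s) s) FZero
| fe_scaleA a b s : fterm_eq (FScale a (FScale b s)) (FScale (a * b) s)
| fe_scale1 s : fterm_eq (FScale 1 s) s
| fe_scaleDr a s t :
    fterm_eq (FScale a (FAdd s t)) (FAdd (FScale a s) (FScale a t))
| fe_scaleDl a b s :
    fterm_eq (FScale (a + b) s) (FAdd (FScale a s) (FScale b s))
| fe_linearl a s t r :
    fterm_eq (FBracket (FAdd (FScale a s) t) r)
             (FAdd (FScale a (FBracket s r)) (FBracket t r))
| fe_linearr a s t r :
    fterm_eq (FBracket r (FAdd (FScale a s) t))
             (FAdd (FScale a (FBracket r s)) (FBracket r t))
| fe_alt s : fterm_eq (FBracket s s) FZero
| fe_jacobi s t r :
    fterm_eq (FAdd (FAdd (FBracket s (FBracket t r))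
                         (FBracket t (FBracket r s)))
                   (FBracket r (FBracket s t))) FZero
| fe_metabelian s t r q :
    fterm_eq (FBracket (FBracket s t) (FBracket r q)) FZero.

Section FreeMetabelian.
Variables (R : comNzRingType) (X : Type).

HB.instance Definition _ := gen_eqMixin (fterm R X).
HB.instance Definition _ := gen_choiceMixin (fterm R X).

Definition fterm_eqb (s t : fterm R X) : bool := `[< fterm_eq s t >].

Lemma fterm_eqb_equiv : equiv_class_of fterm_eqb.
Proof.
split=> [s|s t|t s r].
- by apply/asboolP; exact: fe_refl.
- by apply/asboolP/asboolP; exact: fe_sym.
- by move=> /asboolP st /asboolP tr; apply/asboolP; exact: fe_trans tr.
Qed.

Canonical fterm_eqb_equivRel := EquivRelPack fterm_eqb_equiv.
Canonical fterm_eqb_encModRel := defaultEncModRel fterm_eqb.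

Definition free_metabelian : Type := {eq_quot fterm_eqb}.
HB.instance Definition _ : EqQuotient (fterm R X) fterm_eqb free_metabelian :=
  EqQuotient.on free_metabelian.
HB.instance Definition _ := Choice.on free_metabelian.

Local Notation F := free_metabelian.
Local Notation cl := (\pi_free_metabelian).

Definition free_gen (x : X) : F := cl (FGen R x).

Lemma fm_eqP (s t : fterm R X) : cl s = cl t <-> fterm_eq s t.
Proof.
split=> [/eqP|st]; first by rewrite piE => /asboolP.
by apply/eqP; rewrite piE; apply/asboolP.
Qed.

Definition fm_opp (u : F) : F := cl (FOpp (repr u)).
Definition fm_add (u v : F) : F := cl (FAdd (repr u) (repr v)).
Definition fm_scale (a : R) (u : F) : F := cl (FScale a (repr u)).
Definition fm_bracket (u v : F) : F := cl (FBracket (repr u) (repr v)).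

Lemma fm_repr (s : fterm R X) : fterm_eq (repr (cl s)) s.
Proof. by apply/fm_eqP; rewrite reprK. Qed.

Lemma fm_oppE s : fm_opp (cl s) = cl (FOpp s).
Proof. by apply/fm_eqP/fe_opp/fm_repr. Qed.
Lemma fm_addE s t : fm_add (cl s) (cl t) = cl (FAdd s t).
Proof. by apply/fm_eqP; apply: fe_add; exact: fm_repr. Qed.
Lemma fm_scaleE a s : fm_scale a (cl s) = cl (FScale a s).
Proof. by apply/fm_eqP/fe_scale/fm_repr. Qed.
Lemma fm_bracketE s t : fm_bracket (cl s) (cl t) = cl (FBracket s t).
Proof. by apply/fm_eqP; apply: fe_bracket; exact: fm_repr. Qed.

Fact fm_addA : associative fm_add.
Proof.
elim/quotW => s; elim/quotW => t; elim/quotW => r.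
by rewrite (fm_addE s t) (fm_addE t r) !fm_addE; apply/fm_eqP; exact: fe_addA.
Qed.
Fact fm_addC : commutative fm_add.
Proof.
elim/quotW => s; elim/quotW => t.
by rewrite (fm_addE s t) (fm_addE t s); apply/fm_eqP; exact: fe_addC.
Qed.
Fact fm_add0 : left_id (cl FZero) fm_add.
Proof. by elim/quotW => s; rewrite fm_addE; apply/fm_eqP; exact: fe_add0. Qed.
Fact fm_addN : left_inverse (cl FZero) fm_opp fm_add.
Proof.
elim/quotW => s; rewrite (fm_oppE s) fm_addE.
by apply/fm_eqP; exact: fe_addN.
Qed.

HB.instance Definition _ :=
  GRing.isZmodule.Build F fm_addA fm_addC fm_add0 fm_addN.

Fact fm_scaleA a b u : fm_scale a (fm_scale b u) = fm_scale (a * b) u.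
Proof.
elim/quotW: u => s; rewrite (fm_scaleE b s) !fm_scaleE.
by apply/fm_eqP; exact: fe_scaleA.
Qed.
Fact fm_scale1 : left_id 1 fm_scale.
Proof. by elim/quotW => s; rewrite fm_scaleE; apply/fm_eqP; exact: fe_scale1. Qed.
Fact fm_scaleDr : right_distributive fm_scale +%R.
Proof.
move=> a; elim/quotW => s; elim/quotW => t.
rewrite -[cl s + cl t]/(fm_add _ _) -[RHS]/(fm_add _ _).
rewrite (fm_addE s t) (fm_scaleE a s) (fm_scaleE a t) fm_scaleE fm_addE.
by apply/fm_eqP; exact: fe_scaleDr.
Qed.
Fact fm_scaleDl u : {morph fm_scale^~ u : a b / a + b}.
Proof.
elim/quotW: u => s a b; rewrite -[RHS]/(fm_add _ _).
rewrite (fm_scaleE a s) (fm_scaleE b s) fm_scaleE fm_addE.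
by apply/fm_eqP; exact: fe_scaleDl.
Qed.

HB.instance Definition _ := GRing.Zmodule_isLmodule.Build R F
  fm_scaleA fm_scale1 fm_scaleDr fm_scaleDl.

Lemma fm_clD s t : cl (FAdd s t) = cl s + cl t.
Proof. by rewrite -fm_addE. Qed.
Lemma fm_clZ a s : cl (FScale a s) = a *: cl s.
Proof. by rewrite -fm_scaleE. Qed.

Fact fm_linearl v : linear (fm_bracket^~ v).
Proof.
elim/quotW: v => r a; elim/quotW => s; elim/quotW => t.
rewrite -fm_clZ -fm_clD (fm_bracketE s r) (fm_bracketE t r) fm_bracketE.
by rewrite -fm_clZ -fm_clD; apply/fm_eqP; exact: fe_linearl.
Qed.
Fact fm_linearr u : linear (fm_bracket u).
Proof.
elim/quotW: u => r a; elim/quotW => s; elim/quotW => t.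
rewrite -fm_clZ -fm_clD (fm_bracketE r s) (fm_bracketE r t) fm_bracketE.
by rewrite -fm_clZ -fm_clD; apply/fm_eqP; exact: fe_linearr.
Qed.
Fact fm_bracketvv u : fm_bracket u u = 0.
Proof. by elim/quotW: u => s; rewrite fm_bracketE; apply/fm_eqP; exact: fe_alt. Qed.
Fact fm_jacobi u v w :
  fm_bracket u (fm_bracket v w) + fm_bracket v (fm_bracket w u)
    + fm_bracket w (fm_bracket u v) = 0.
Proof.
elim/quotW: u => s; elim/quotW: v => t; elim/quotW: w => r.
rewrite (fm_bracketE t r) (fm_bracketE r s) (fm_bracketE s t) !fm_bracketE.
by rewrite -!fm_clD; apply/fm_eqP; exact: fe_jacobi.
Qed.

HB.instance Definition _ := isLieAlgebra.Build R F
  fm_linearl fm_linearr fm_bracketvv fm_jacobi.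

Lemma free_metabelianP : metabelian F.
Proof.
elim/quotW => s; elim/quotW => t; elim/quotW => r; elim/quotW => q.
rewrite /bracket /= (fm_bracketE s t) (fm_bracketE r q) fm_bracketE.
by apply/fm_eqP; exact: fe_metabelian.
Qed.

Section Lift.
Variables (L : lieAlgType R) (f : X -> L).

Fixpoint fterm_eval (s : fterm R X) : L :=
  match s with
  | FGen x => f x
  | FZero => 0
  | FOpp s => - fterm_eval s
  | FAdd s t => fterm_eval s + fterm_eval t
  | FScale a s => a *: fterm_eval s
  | FBracket s t => bracket (fterm_eval s) (fterm_eval t)
  end.

Definition free_lift (u : F) : L := fterm_eval (repr u).

Hypothesis Lmet : metabelian L.

Lemma fterm_eval_eq s t : fterm_eq s t -> fterm_eval s = fterm_eval t.
Proof.
elim=> //=; try by move=> *; congruence.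
- by move=> *; rewrite addrA.
- by move=> *; rewrite addrC.
- by move=> *; rewrite add0r.
- by move=> *; rewrite addNr.
- by move=> *; rewrite scalerA.
- by move=> *; rewrite scale1r.
- by move=> *; rewrite scalerDr.
- by move=> *; rewrite scalerDl.
- by move=> a s' t' r; have /= -> := bracket_linearl (fterm_eval r) a.
- by move=> a s' t' r; have /= -> := bracket_linearr (fterm_eval r) a.
- by move=> *; rewrite bracketvv.
- by move=> *; rewrite jacobi.
Qed.

Lemma free_liftE s : free_lift (cl s) = fterm_eval s.
Proof. exact/fterm_eval_eq/fm_repr. Qed.

Lemma free_lift_gen x : free_lift (free_gen x) = f x.
Proof. by rewrite free_liftE. Qed.

Lemma free_lift_morphism : lie_morphism free_lift.
Proof.
split=> [a|]; elim/quotW => s; elim/quotW => t.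
  by rewrite -fm_clZ -fm_clD !free_liftE.
by rewrite /bracket /= fm_bracketE !free_liftE.
Qed.

Lemma free_lift_unique (g : F -> L) : lie_morphism g ->
  (forall x, g (free_gen x) = f x) -> g =1 free_lift.
Proof.
move=> [glin gbr] gf; have g0 : g 0 = 0.
  by have := glin (-1) 0 0; rewrite scaleN1r oppr0 addr0 scaleN1r addNr.
have gD u v : g (u + v) = g u + g v by have := glin 1 u v; rewrite !scale1r.
have gZ a u : g (a *: u) = a *: g u.
  by have := glin a u 0; rewrite g0 !addr0.
elim/quotW => s; rewrite free_liftE; elim: s => [x||s IH|s IHs t IHt|a s IH|s IHs t IHt] /=.
- exact: gf.
- exact: g0.
- by rewrite -fm_oppE -[fm_opp _]/(- cl s) -scaleN1r gZ IH scaleN1r.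
- by rewrite fm_clD gD IHs IHt.
- by rewrite fm_clZ gZ IH.
- by rewrite -fm_bracketE gbr IHs IHt.
Qed.

End Lift.

End FreeMetabelian.

Arguments free_gen R {X} x.

(** * Partially commutative metabelian Lie algebras *)

Definition edge_brackets (R : comNzRingType) (X : Type) (e : rel X) :
    free_metabelian R X -> Prop :=
  fun u => exists x y, e x y /\ u = bracket (free_gen R x) (free_gen R y).

Definition pcm_lie (R : comNzRingType) (X : Type) (e : rel X) : lieAlgType R :=
  lie_quot (@edge_brackets R X e).

(** * Graphs *)

Section Graph.
Variables (X : finType) (e : rel X).

(* d(x, y) <= n : some walk of length at most n leads from x to y. *)
Definition dist_le (n : nat) (x y : X) : bool :=
  [exists p : n.-bseq X, path e x p && (last x p == y)].

Definition perp (x : X) : {set X} := [set y | dist_le 1 x y].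

Lemma in_perp x y : (y \in perp x) = (y == x) || e x y.
Proof.
rewrite inE; apply/existsP/orP => [[[[|z [|//]] /= _]]|].
- by move/eqP->; left.
- by rewrite andbT => /andP[exz /eqP <-]; right.
case=> [/eqP->|exy]; first by exists [bseq]; rewrite /= eqxx.
by exists [bseq y]; rewrite /= exy eqxx.
Qed.

Definition perp_equiv : rel X := [rel x y | perp x == perp y].

Definition perp_class (x : X) : {set X} := [set y | perp_equiv x y].

End Graph.

(* [G(X \ {x})], on the type of the vertices other than [x] *)
Definition del_vertex (X : finType) (e : rel X) (x : X) :
    rel {y : X | y != x} :=
  fun u v => e (val u) (val v).

Arguments del_vertex {X} e x u v.

(** * Universal sentences in the language (=, +, [.,.], 0) *)

Inductive lie_term (k : nat) : Type :=
| TVar of 'I_k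
| TZero
| TAdd of lie_term k & lie_term k
| TBracket of lie_term k & lie_term k.

Inductive qf_formula (k : nat) : Type :=
| QEq of lie_term k & lie_term k
| QNot of qf_formula k
| QAnd of qf_formula k & qf_formula k
| QOr of qf_formula k & qf_formula k
| QImp of qf_formula k & qf_formula k.

Arguments TZero {k}.

Section Semantics.
Variables (R : comNzRingType) (L : lieAlgType R) (k : nat).

Fixpoint term_val (w : 'I_k -> L) (t : lie_term k) : L :=
  match t with
  | TVar i => w i
  | TZero => 0
  | TAdd s t => term_val w s + term_val w t
  | TBracket s t => bracket (term_val w s) (term_val w t)
  end.

Fixpoint holds (w : 'I_k -> L) (phi : qf_formula k) : Prop :=
  match phi with
  | QEq s t => term_val w s = term_val w t
  | QNot phi => ~ holds w phi
  | QAnd phi psi => holds w phi /\ holds w psi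
  | QOr phi psi => holds w phi \/ holds w psi
  | QImp phi psi => holds w phi -> holds w psi
  end.

Definition satisfies_forall (phi : qf_formula k) : Prop :=
  forall w : 'I_k -> L, holds w phi.

End Semantics.

Definition universally_equivalent (R R' : comNzRingType) (L : lieAlgType R)
    (L' : lieAlgType R') : Prop :=
  forall (k : nat) (phi : qf_formula k),
    satisfies_forall L phi <-> satisfies_forall L' phi.

(* Main.v *)
(* Let [y] be a twin of [x], i.e. [y != x] and [perp x = perp y].  The inclusion
   M(X'; G') -> M(X; G) is split by [x |-> n y], for every natural [n], so the point
   is that these retractions [merge n] discriminate M(X; G): a nonzero [u] has
   [merge n u != 0] for all large [n].

   A family [(tau_i, c_i)] with [c_i = c_j] whenever [i], [j] are adjacent and
   [tau_i], [tau_j] are nonzero gives a morphism [i |-> tau_i (1, c_i)] from M(X; G)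
   to the two-dimensional algebra [aff R], and these morphisms separate points: in
   multidegree [k], elements of M(X; G) are sums [sum_l b_l (v_(i_l) - v_(j_l))] with
   [v] constant on the components of the graph induced on the support of [k], and
   they are mapped to [tau^k sum_l b_l (c_(j_l) - c_(i_l))].  Finally, twins can be
   given the same [c], and then the image of [u] is polynomial in [tau_x]; it
   vanishes at [tau_x = n tau_y] if [merge n u = 0], so infinitely many such [n]
   force it to vanish. *)
Require Import Defs.
From HB Require Import structures.
From mathcomp Require Import all_boot all_order all_algebra generic_quotient.
From mathcomp Require Import boolp ring.

Set Implicit Arguments.
Unset Strict Implicit.
Unset Printing Implicit Defensive.

Import GRing.Theory.
Local Open Scope ring_scope.
Local Open Scope quotient_scope.

(** * Lie algebras and their presentations *)

Section LieTheory.
Variables (R : comNzRingType) (L : lieAlgType R).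
Implicit Types (a : R) (u v w : L).

Lemma bracketDl u v w : bracket (u + v) w = bracket u w + bracket v w.
Proof. by have /= := bracket_linearl w 1 u v; rewrite !scale1r. Qed.

Lemma bracketDr u v w : bracket w (u + v) = bracket w u + bracket w v.
Proof. by have /= := bracket_linearr w 1 u v; rewrite !scale1r. Qed.

Lemma bracket0l w : bracket 0 w = 0 :> L.
Proof. by apply: (addrI (bracket 0 w)); rewrite -bracketDl !addr0. Qed.

Lemma bracket0r w : bracket w 0 = 0 :> L.
Proof. by rewrite bracketC bracket0l oppr0. Qed.

Lemma bracketZl a u w : bracket (a *: u) w = a *: bracket u w.
Proof. by have /= := bracket_linearl w a u 0; rewrite bracket0l !addr0. Qed.

Lemma bracketZr a u w : bracket w (a *: u) = a *: bracket w u.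
Proof. by have /= := bracket_linearr w a u 0; rewrite bracket0r !addr0. Qed.

Lemma bracketNr u w : bracket w (- u) = - bracket w u.
Proof. by rewrite -scaleN1r bracketZr scaleN1r. Qed.

Lemma bracket_suml I (r : seq I) (F : I -> L) w :
  bracket (\sum_(i <- r) F i) w = \sum_(i <- r) bracket (F i) w.
Proof.
by apply: (big_morph (bracket^~ w)) => [u v|]; [exact: bracketDl|exact: bracket0l].
Qed.

Lemma bracket_sumr I (r : seq I) (F : I -> L) w :
  bracket w (\sum_(i <- r) F i) = \sum_(i <- r) bracket w (F i).
Proof.
by apply: (big_morph (bracket w)) => [u v|]; [exact: bracketDr|exact: bracket0r].
Qed.

End LieTheory.

Section LieMorphism.
Variables (R : comNzRingType) (L L' : lieAlgType R) (g : L -> L').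
Hypothesis gM : lie_morphism g.

Lemma lie_morphismZD a u v : g (a *: u + v) = a *: g u + g v.
Proof. exact: gM.1. Qed.

Lemma lie_morphismD u v : g (u + v) = g u + g v.
Proof. by have := lie_morphismZD 1 u v; rewrite !scale1r. Qed.

Lemma lie_morphism0 : g 0 = 0.
Proof. by apply: (addrI (g 0)); rewrite -lie_morphismD !addr0. Qed.

Lemma lie_morphismZ a u : g (a *: u) = a *: g u.
Proof. by have := lie_morphismZD a u 0; rewrite lie_morphism0 !addr0. Qed.

Lemma lie_morphismN u : g (- u) = - g u.
Proof. by rewrite -scaleN1r lie_morphismZ scaleN1r. Qed.

Lemma lie_morphismB u v : g (u - v) = g u - g v.
Proof. by rewrite lie_morphismD lie_morphismN. Qed.

Lemma fterm_eval_morphism (X : Type) (f : X -> L) (t : fterm R X) :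
  g (fterm_eval f t) = fterm_eval (g \o f) t.
Proof.
elim: t => [x||s IH|s IHs t IHt|a s IH|s IHs t IHt] //=.
- exact: lie_morphism0.
- by rewrite lie_morphismN IH.
- by rewrite lie_morphismD IHs IHt.
- by rewrite lie_morphismZ IH.
- by rewrite gM.2 IHs IHt.
Qed.

Lemma term_val_morphism k (w : 'I_k -> L) (t : lie_term k) :
  g (term_val w t) = term_val (g \o w) t.
Proof.
elim: t => [i||s IHs t IHt|s IHs t IHt] //=.
- exact: lie_morphism0.
- by rewrite lie_morphismD IHs IHt.
- by rewrite gM.2 IHs IHt.
Qed.

(** Atoms are equations, which an injective morphism preserves and reflects; hence universal
    sentences pass to subalgebras. *)
Lemma holds_inj_morphism k (w : 'I_k -> L) (phi : qf_formula k) :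
  injective g -> holds (g \o w) phi <-> holds w phi.
Proof.
move=> g_inj; elim: phi => [s t|phi IH|p IHp q IHq|p IHp q IHq|p IHp q IHq] /=;
  [|tauto..].
by rewrite -!term_val_morphism; split=> [/g_inj|->].
Qed.

End LieMorphism.

Lemma fterm_eval_ext (R : comNzRingType) (L : lieAlgType R) (X : Type)
    (f f' : X -> L) (t : fterm R X) :
  f =1 f' -> fterm_eval f t = fterm_eval f' t.
Proof. by move=> ff'; elim: t => //= *; congruence. Qed.

(** * Universal property of [M(X; G)] *)

Section PartiallyCommutative.
Variables (R : comNzRingType) (X : Type) (e : rel X).
Local Notation M := (pcm_lie R e).

Definition pcm_class (t : fterm R X) : M :=
  \pi_(lie_quot (@edge_brackets R X e)) (\pi_(free_metabelian R X) t).

Definition pcm_gen (x : X) : M := pcm_class (FGen R x).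

Lemma pcm_classE (t : fterm R X) : pcm_class t = fterm_eval pcm_gen t.
Proof.
have piM := lie_quot_pi_morphism (@edge_brackets R X e).
have idM : lie_morphism (@id (free_metabelian R X)) by [].
have := free_lift_unique (@free_metabelianP R X) idM (fun=> erefl).
rewrite /pcm_class => /(_ (\pi_(free_metabelian R X) t)) /= ->.
rewrite free_liftE; last exact: free_metabelianP.
exact: fterm_eval_morphism piM _ _ _.
Qed.

Lemma pcm_classP (u : M) : exists t, u = pcm_class t.
Proof.
elim/quotW: u => v; elim/quotW: v => t; by exists t.
Qed.

Lemma pcm_metabelian : metabelian M.
Proof.
have [_ piM] := lie_quot_pi_morphism (@edge_brackets R X e).
move=> a b c d; elim/quotW: a => a; elim/quotW: b => b.
elim/quotW: c => c; elim/quotW: d => d.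
by rewrite -!piM free_metabelianP lie_quot0.
Qed.

Lemma pcm_gen_edge x y : e x y -> bracket (pcm_gen x) (pcm_gen y) = 0.
Proof.
move=> exy; have [_ piM] := lie_quot_pi_morphism (@edge_brackets R X e).
rewrite /pcm_gen /pcm_class -piM -[RHS]lie_quot0; apply/lie_quot_eqP.
by rewrite subr0; apply: ideal_gen_sub; exists x, y.
Qed.

Section Lift.
Variables (L : lieAlgType R) (f : X -> L).
Hypothesis Lmet : metabelian L.
Hypothesis f_edge : forall x y, e x y -> bracket (f x) (f y) = 0.

(** The kernel of [free_lift f] is an ideal containing the edge brackets, hence contains the ideal
    they generate. *)
Lemma pcm_class_eval s t : pcm_class s = pcm_class t ->
  fterm_eval f s = fterm_eval f t.
Proof.
have liftM := free_lift_morphism f Lmet.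
move/lie_quot_eqP/asboolP => /(_ (fun u => free_lift f u = 0)).
move=> H; apply/eqP; rewrite -subr_eq0 -!(free_liftE f Lmet).
rewrite -(lie_morphismB liftM); apply/eqP; apply: H.
- split=> [|a u v u0 v0|u v v0]; first exact: lie_morphism0.
  + by rewrite (lie_morphismZD liftM) u0 v0 scaler0 addr0.
  + by rewrite liftM.2 v0 bracket0r.
- move=> _ [x [y [exy ->]]]; rewrite liftM.2 !free_lift_gen //.
  exact: f_edge.
Qed.

Definition pcm_lift (u : M) : L := free_lift f (repr u).

Lemma pcm_liftE t : pcm_lift (pcm_class t) = fterm_eval f t.
Proof.
rewrite /pcm_lift /free_lift; apply: pcm_class_eval.
by rewrite /pcm_class !reprK.
Qed.

Lemma pcm_lift_gen x : pcm_lift (pcm_gen x) = f x.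
Proof. exact: pcm_liftE. Qed.

Lemma pcm_lift_morphism : lie_morphism pcm_lift.
Proof.
split=> [a u v|u v]; have [s ->] := pcm_classP u; have [t ->] := pcm_classP v.
  have -> : a *: pcm_class s + pcm_class t = pcm_class (FAdd (FScale a s) t).
    by rewrite !pcm_classE.
  by rewrite !pcm_liftE.
have -> : bracket (pcm_class s) (pcm_class t) = pcm_class (FBracket s t).
  by rewrite !pcm_classE.
by rewrite !pcm_liftE.
Qed.

End Lift.
End PartiallyCommutative.

Arguments pcm_gen {R X} e x.
Arguments pcm_class {R X} e t.

(** * Iterated commutators in metabelian algebras *)

Section LeftNormed.
Variables (R : comNzRingType) (X : eqType) (L : lieAlgType R) (f : X -> L).
Hypothesis Lmet : metabelian L.

Definition ad_seq (s : seq X) (v : L) : L := foldr (fun p => bracket (f p)) v s.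

Definition comm_word (w : seq X * (X * X)) : L :=
  ad_seq w.1 (bracket (f w.2.1) (f w.2.2)).

Lemma ad_seqD s u v : ad_seq s (u + v) = ad_seq s u + ad_seq s v.
Proof. by elim: s => //= p s ->; rewrite bracketDr. Qed.

Lemma ad_seqN s u : ad_seq s (- u) = - ad_seq s u.
Proof. by elim: s => //= p s ->; rewrite bracketNr. Qed.

Lemma ad_seq0 s : ad_seq s 0 = 0.
Proof. by elim: s => //= p s ->; rewrite bracket0r. Qed.

Lemma ad_seq_bracket s u v : exists u' v', ad_seq s (bracket u v) = bracket u' v'.
Proof.
by case: s => [|p s]; [exists u, v | exists (f p), (ad_seq s (bracket u v))].
Qed.

(** In the Jacobi identity the term [[u, v], [p, q]] vanishes, so adjoint operators commute on
    commutators. *)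
Lemma ad_comm (p q u v : L) :
  bracket p (bracket q (bracket u v)) = bracket q (bracket p (bracket u v)).
Proof.
have := jacobi p q (bracket u v); rewrite Lmet addr0.
rewrite [bracket (bracket u v) p]bracketC bracketNr => /eqP.
by rewrite subr_eq0 => /eqP.
Qed.

Lemma ad_seq_cons_bracket p s u v :
  ad_seq s (bracket (f p) (bracket u v)) = bracket (f p) (ad_seq s (bracket u v)).
Proof.
elim: s => //= q s ->; have [u' [v' ->]] := ad_seq_bracket s u v.
exact: ad_comm.
Qed.

Lemma ad_seq_perm s s' u v : perm_eq s s' ->
  ad_seq s (bracket u v) = ad_seq s' (bracket u v).
Proof.
elim: s s' => [|p s IH] s' ss'.
  by move: ss'; rewrite perm_sym => /perm_nilP ->.
have ps' : p \in s' by rewrite -(perm_mem ss') mem_head.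
have ss : perm_eq s (rem p s').
  by rewrite -(perm_cons p) (perm_trans ss') // perm_to_rem.
rewrite /= (IH _ ss); have [u' [v' E]] := ad_seq_bracket (rem p s') u v.
elim: s' ps' {ss' ss IH u' v' E} => //= q s' IH; rewrite inE.
case: (eqVneq q p) => [->//|qp] /= => /IH <-.
have [u' [v' ->]] := ad_seq_bracket (rem p s') u v; exact: ad_comm.
Qed.

End LeftNormed.

(* The coefficients depend on the term only, not on the algebra in which it is
   evaluated. *)
Lemma fterm_normal_form (R : comNzRingType) (X : finType) (t : fterm R X) :
  exists (a : X -> R) (s : seq (R * (seq X * (X * X)))),
    forall (L : lieAlgType R) (f : X -> L), metabelian L ->
      fterm_eval f t
      = \sum_i a i *: f i + \sum_(l <- s) l.1 *: comm_word f l.2.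
Proof.
elim: t => [x||t [a [s IH]]|t [a [s IH]] t' [a' [s' IH']]
           |b t [a [s IH]]|t [a [s IH]] t' [a' [s' IH']]].
- exists (fun i => (i == x)%:R), [::] => L f _.
  rewrite big_nil addr0 (bigD1 x) //= eqxx scale1r big1 ?addr0 // => i /negPf ->.
  by rewrite scale0r.
- exists (fun=> 0), [::] => L f _.
  by rewrite big_nil addr0 big1 // => i _; rewrite scale0r.
- exists (fun i => - a i), [seq (- l.1, l.2) | l <- s] => L f Lm /=.
  rewrite (IH _ _ Lm) big_map opprD -!sumrN; congr (_ + _);
  by apply: eq_bigr => i _; rewrite scaleNr.
- exists (fun i => a i + a' i), (s ++ s') => L f Lm /=.
  rewrite (IH _ _ Lm) (IH' _ _ Lm) big_cat /= addrACA; congr (_ + _).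
  by rewrite -big_split; apply: eq_bigr => i _; rewrite scalerDl.
- exists (fun i => b * a i), [seq (b * l.1, l.2) | l <- s] => L f Lm /=.
  rewrite (IH _ _ Lm) big_map scalerDr !scaler_sumr; congr (_ + _);
  by apply: eq_bigr => i _; rewrite scalerA.
(* A bracket of two normal forms expands into linear by linear, linear by commutator and, with a
   sign change, commutator by linear; commutator by commutator is 0 by metabelianity. *)
exists (fun=> 0),
  ([seq (a i * a' j, ([::], (i, j))) | i <- index_enum X, j <- index_enum X]
   ++ [seq (a i * l.1, (i :: l.2.1, l.2.2)) | i <- index_enum X, l <- s']
   ++ [seq (- (a' i * l.1), (i :: l.2.1, l.2.2)) | i <- index_enum X, l <- s]).
move=> L f Lm /=; rewrite (IH _ _ Lm) (IH' _ _ Lm).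
rewrite [X in _ = X + _]big1 ?add0r => [|i _]; last by rewrite scale0r.
rewrite !big_cat /= !big_allpairs_dep bracketDl !bracketDr -!addrA; congr (_ + _).
  rewrite bracket_suml; apply: eq_bigr => i _; rewrite bracket_sumr.
  by apply: eq_bigr => j _; rewrite bracketZl bracketZr scalerA.
congr (_ + _).
  rewrite bracket_suml; apply: eq_bigr => i _; rewrite bracket_sumr.
  by apply: eq_bigr => j _; rewrite bracketZl bracketZr scalerA.
rewrite [X in _ + X](_ : _ = 0) ?addr0.
  rewrite bracketC bracket_suml -sumrN; apply: eq_bigr => i _.
  rewrite bracket_sumr -sumrN; apply: eq_bigr => j _.
  by rewrite bracketZl bracketZr scalerA scaleNr.
rewrite bracket_suml big1 // => l _; rewrite bracket_sumr big1 // => l' _.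
rewrite bracketZl bracketZr /comm_word.
have [u [v ->]] := ad_seq_bracket f l.2.1 (f l.2.2.1) (f l.2.2.2).
have [u' [v' ->]] := ad_seq_bracket f l'.2.1 (f l'.2.2.1) (f l'.2.2.2).
by rewrite Lm !scaler0.
Qed.

(** * Multihomogeneous components *)

Lemma perm_rem_cons (T : eqType) (x : T) (s r : seq T) :
  perm_eq (x :: r) s -> perm_eq r (rem x s).
Proof.
move=> rs; have xs : x \in s by rewrite -(perm_mem rs) mem_head.
by rewrite -(perm_cons x) (perm_trans rs) // perm_to_rem.
Qed.

Lemma perm_swap2 (T : eqType) (x y : T) (s : seq T) :
  perm_eq [:: x, y & s] [:: y, x & s].
Proof. by rewrite (permEl (perm_catCA [:: x] [:: y] s)). Qed.

Section Cocycle.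
Variables (R : comNzRingType) (X : eqType) (L : lieAlgType R) (f : X -> L).
Hypothesis Lmet : metabelian L.

Lemma comm_word_perm s s' ij : perm_eq s s' ->
  comm_word f (s, ij) = comm_word f (s', ij).
Proof. exact: ad_seq_perm. Qed.

Lemma comm_wordC s i j : comm_word f (s, (i, j)) = - comm_word f (s, (j, i)).
Proof. by rewrite /comm_word /= bracketC ad_seqN. Qed.

Lemma comm_word0 s i j : bracket (f i) (f j) = 0 -> comm_word f (s, (i, j)) = 0.
Proof. by rewrite /comm_word /= => ->; rewrite ad_seq0. Qed.

(** With the multiset [sigma] of all letters fixed, a commutator depends only on its inner bracket
    [i, j]; this is a primitive of that function of (i, j), normalised to vanish at the base letter
    [b]. *)
Definition word_potential (sigma : seq X) (b i : X) : L :=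
  if i == b then 0 else comm_word f (rem b (rem i sigma), (i, b)).

(* In a fixed multidegree sigma, the Jacobi identity is the cocycle relation
   w_ij + w_jb + w_bi = 0, so that w is a coboundary. *)
Lemma comm_word_potential sigma b s i j :
    perm_eq [:: i, j & s] sigma -> b \in sigma ->
  comm_word f (s, (i, j)) = word_potential sigma b i - word_potential sigma b j.
Proof.
move=> ps bs; have ps' : perm_eq [:: j, i & s] sigma.
  exact: perm_trans (perm_swap2 _ _ _) ps.
have [->|ij] := eqVneq i j; first by rewrite subrr comm_word0 ?bracketvv.
rewrite /word_potential; have [ib|ib] := eqVneq i b.
  rewrite -ib eq_sym (negPf ij) sub0r comm_wordC; congr (- _).
  by apply: comm_word_perm; do 2!apply: perm_rem_cons.
have [jb|jb] := eqVneq j b.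
  by rewrite -jb subr0; apply: comm_word_perm; do 2!apply: perm_rem_cons.
(* As [b] differs from [i] and [j], it is one of the outer letters. Moved next to the inner bracket,
   it reduces the claim to the Jacobi identity for [f b], [f i], [f j]. *)
have bs' : b \in s.
  by move: bs; rewrite -(perm_mem ps) !inE ![b == _]eq_sym (negPf ib) (negPf jb).
have pb := perm_to_rem bs'.
rewrite (comm_word_perm _ (pb : perm_eq s (b :: rem b s))).
have /perm_rem_cons/perm_rem_cons pj :
    perm_eq [:: i, b, j & rem b s] sigma.
  apply: perm_trans ps; rewrite perm_cons (perm_trans (perm_swap2 _ _ _)) //=.
  by rewrite perm_cons perm_sym.
have /perm_rem_cons/perm_rem_cons pi :
    perm_eq [:: j, b, i & rem b s] sigma.
  apply: perm_trans ps'; rewrite perm_cons (perm_trans (perm_swap2 _ _ _)) //=.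
  by rewrite perm_cons perm_sym.
rewrite -(comm_word_perm _ pj) -(comm_word_perm _ pi) /comm_word /=.
rewrite -!ad_seq_cons_bracket // -ad_seqN -ad_seqD; congr (ad_seq _ _ _).
have := jacobi (f b) (f i) (f j); rewrite -addrA => /eqP; rewrite addr_eq0 => /eqP ->.
rewrite opprD addrC [bracket (f b) (f i)]bracketC bracketNr opprK.
by rewrite [bracket (f j) (f b)]bracketC; rewrite addrC bracketNr opprK addrC.
Qed.

End Cocycle.

(** * Monomials and their linear independence *)

Section Monomials.
Variables (R : comNzRingType) (X : finType).
Implicit Types (tau : X -> R) (k : {ffun X -> nat}).

Definition monomial_val tau k : R := \prod_p tau p ^+ k p.

Definition multidegree (w : seq X * (X * X)) : {ffun X -> nat} :=
  [ffun p => count_mem p [:: w.2.1, w.2.2 & w.1]].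

Lemma multidegree_eqP s i j s' i' j' :
  multidegree (s, (i, j)) = multidegree (s', (i', j')) ->
  perm_eq [:: i, j & s] [:: i', j' & s'].
Proof.
by move=> /ffunP ww'; apply/allP => p _; have := ww' p; rewrite !ffunE => /= ->.
Qed.

Lemma prod_count_mem tau (s : seq X) :
  \prod_p tau p ^+ count_mem p s = \prod_(p <- s) tau p.
Proof.
elim: s => [|q s IH] /=; first by rewrite big_nil big1.
rewrite big_cons -IH.
under eq_bigr => p _ do rewrite exprD.
rewrite big_split /=; congr (_ * _).
rewrite (bigD1 q) //= eqxx big1 ?mulr1 // => p.
by rewrite eq_sym => /negPf ->.
Qed.

Lemma monomial_val_multidegree tau s i j :
  monomial_val tau (multidegree (s, (i, j))) = tau i * (tau j * \prod_(p <- s) tau p).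
Proof.
rewrite /monomial_val; under eq_bigr => p _ do rewrite ffunE.
by rewrite prod_count_mem !big_cons.
Qed.

Lemma monomial_valM tau tau' k :
  monomial_val (fun p => tau p * tau' p) k = monomial_val tau k * monomial_val tau' k.
Proof. by rewrite -big_split; apply: eq_bigr => p _; rewrite exprMn. Qed.

End Monomials.

Section Independence.
Variables (R : idomainType) (X : finType).
Hypothesis natR_inj : injective (fun n : nat => n%:R : R).

Lemma natr_eq0 n : ((n%:R : R) == 0) = (n == 0%N).
Proof. by apply/eqP/eqP => [n0|->//]; apply: natR_inj. Qed.

(** If the support of [k1] lies in that of [k0], the value 2 at a vertex where they differ and 1 on
    the rest of the support of [k0] gives two distinct powers of 2. Otherwise vanishing off the
    support of [k0] kills the monomial of [k1] but not that of [k0]. *)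
Lemma monomial_separation (k0 k1 : {ffun X -> nat}) : k1 != k0 ->
  exists2 tau : X -> R, forall p, k0 p = 0%N -> tau p = 0
    & monomial_val tau k0 != monomial_val tau k1.
Proof.
move=> k10; have [p kp] : exists p, k0 p != k1 p.
  apply/existsP; apply: contraNT k10; rewrite negb_exists => /forallP k01.
  by apply/eqP/ffunP => p; apply/esym/eqP; have := k01 p; rewrite negbK.
pose tau q : R := if k0 q == 0%N then 0 else if q == p then 2 else 1.
have val_tau (k : {ffun X -> nat}) : (forall q, k0 q = 0%N -> k q = 0%N) ->
    monomial_val tau k = 2 ^+ k p.
  move=> kS; rewrite /monomial_val (bigD1 p) //= big1 ?mulr1 => [|q qp].
    rewrite /tau eqxx; case: eqP => // /kS ->; by rewrite !expr0.
  rewrite /tau (negPf qp); case: eqP => [/kS ->|_]; by rewrite ?expr0 ?expr1n.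
exists tau => [q k0q|]; first by rewrite /tau k0q.
rewrite val_tau //; apply/eqP.
have [/forallP kS|] := boolP [forall q, (k0 q == 0%N) ==> (k1 q == 0%N)].
  rewrite val_tau => [|q /eqP k0q]; last by apply/eqP/(implyP (kS q)).
  rewrite -!natrX => /natR_inj /eqP; rewrite eqn_exp2l // => /eqP.
  by move/eqP: kp.
rewrite negb_forall => /existsP [q]; rewrite negb_imply => /andP [k0q k1q].
rewrite [X in _ = X](_ : _ = 0); last first.
  by rewrite /monomial_val (bigD1 q) //= /tau k0q expr0n (negPf k1q) mul0r.
by apply/eqP; rewrite -natrX natr_eq0 expn_eq0.
Qed.

(* Dedekind's independence of characters: multiplying the relation by the factors
   [monomial_val tau - const] kills all multidegrees except [k0]. *)
Lemma monomial_independence (I : Type) (s : seq I) (kappa : I -> {ffun X -> nat})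
    (b : I -> R) (k0 : {ffun X -> nat}) :
  (forall tau : X -> R, (forall p, k0 p = 0%N -> tau p = 0) ->
     \sum_(l <- s) b l * monomial_val tau (kappa l) = 0) ->
  \sum_(l <- s | kappa l == k0) b l = 0.
Proof.
move=> bs0.
have killer (D : seq {ffun X -> nat}) : k0 \notin D ->
    exists h : {ffun X -> nat} -> R,
    [/\ h k0 != 0, {in D, forall k, h k = 0}
      & forall tau : X -> R, (forall p, k0 p = 0%N -> tau p = 0) ->
        \sum_(l <- s) b l * h (kappa l) * monomial_val tau (kappa l) = 0].
  elim: D => [_|k1 D IH].
    exists (fun=> 1); split=> // [|tau /bs0 bs]; first exact: oner_neq0.
    by under eq_bigr => l _ do rewrite mulr1.
  rewrite inE negb_or => /andP [k01 /IH [h [h0 hD hs]]].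
  have [|tau0 tau0S tau01] := @monomial_separation k0 k1; first by rewrite eq_sym.
  exists (fun k => h k * (monomial_val tau0 k - monomial_val tau0 k1)); split.
  - by rewrite mulf_neq0 // subr_eq0.
  - by move=> k; rewrite inE => /orP [/eqP ->|/hD ->]; rewrite ?subrr ?mulr0 ?mul0r.
  move=> tau tauS.
  have e1 := hs _ tauS.
  (* The support condition survives multiplication by [tau0], so the relation may be evaluated at
     the product; subtracting a multiple of [e1] inserts the new factor. *)
  have e2 : \sum_(l <- s) b l * h (kappa l) *
      monomial_val (fun p => tau0 p * tau p) (kappa l) = 0.
    by apply: hs => p /tauS ->; rewrite mulr0.
  transitivity (\sum_(l <- s) b l * h (kappa l) *
      monomial_val (fun p => tau0 p * tau p) (kappa l)
    - monomial_val tau0 k1 *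
      \sum_(l <- s) b l * h (kappa l) * monomial_val tau (kappa l)).
    rewrite mulr_sumr -sumrB; apply: eq_bigr => l _; rewrite monomial_valM; ring.
  by rewrite e1 e2 mulr0 subrr.
have [|h [h0 hD hs]] := killer [seq k <- map kappa s | k != k0].
  by rewrite mem_filter eqxx.
(* At the indicator of the support of [k0] the monomial of [k0] is 1, while [h] kills every other
   multidegree that occurs. *)
pose tau p : R := if k0 p == 0%N then 0 else 1.
have tauS p : k0 p = 0%N -> tau p = 0 by rewrite /tau => ->.
have tau1 : monomial_val tau k0 = 1.
  rewrite /monomial_val big1 // => p _; rewrite /tau.
  by case: eqP => [->|_]; rewrite ?expr0 ?expr1n.
apply: (mulfI h0); rewrite mulr0 -[RHS](hs tau tauS) mulr_sumr big_mkcond.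
elim: s hD {bs0 killer hs} => [|l s IH] hD; first by rewrite !big_nil.
rewrite !big_cons IH => [|k ks]; last first.
  by apply: hD; rewrite /=; case: ifP => // _; rewrite inE ks orbT.
congr (_ + _); case: eqP => [->|/eqP lk]; first by rewrite tau1; ring.
by rewrite hD ?mulr0 ?mul0r //= lk mem_head.
Qed.

End Independence.

(** * The two-dimensional Lie algebra *)

Definition aff (R : comNzRingType) : Type := (R^o * R^o)%type.
HB.instance Definition _ (R : comNzRingType) := GRing.Lmodule.on (aff R).

Section Affine.
Variable R : comNzRingType.
Implicit Types u v w : aff R.

(** With a = (1, 0) and b = (0, 1) this is [a, b] = b: the Lie algebra of the affine group of the
    line. *)
Definition aff_bracket u v : aff R := (0, u.1 * v.2 - v.1 * u.2).

Lemma aff_eqP u v : u.1 = v.1 -> u.2 = v.2 -> u = v.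
Proof. by case: u v => [a p] [b q] /= -> ->. Qed.

Fact aff_linearl v : linear (aff_bracket^~ v).
Proof.
move=> a u w; apply: aff_eqP; first by rewrite /= scaler0 addr0.
by rewrite /= /GRing.scale /=; ring.
Qed.

Fact aff_linearr u : linear (aff_bracket u).
Proof.
move=> a v w; apply: aff_eqP; first by rewrite /= scaler0 addr0.
by rewrite /= /GRing.scale /=; ring.
Qed.

Fact aff_bracketvv u : aff_bracket u u = 0.
Proof. by rewrite /aff_bracket subrr. Qed.

Fact aff_jacobi u v w :
  aff_bracket u (aff_bracket v w) + aff_bracket v (aff_bracket w u)
    + aff_bracket w (aff_bracket u v) = 0.
Proof. by apply: aff_eqP => /=; ring. Qed.

HB.instance Definition _ := isLieAlgebra.Build R (aff R)
  aff_linearl aff_linearr aff_bracketvv aff_jacobi.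

Lemma aff_bracketE u v : bracket u v = (0, u.1 * v.2 - v.1 * u.2) :> aff R.
Proof. by []. Qed.

Lemma aff_metabelian : metabelian (aff R).
Proof. by move=> a b c d; rewrite !aff_bracketE /= !mul0r subrr. Qed.

Lemma aff_sum I (r : seq I) (F : I -> aff R) :
  \sum_(i <- r) F i = (\sum_(i <- r) (F i).1, \sum_(i <- r) (F i).2).
Proof.
elim: r => [|i r IH]; first by rewrite !big_nil.
by rewrite !big_cons IH.
Qed.

Variable X : finType.
Implicit Types tau c : X -> R.

Definition aff_point tau c (i : X) : aff R := (tau i, tau i * c i).

Definition aff_compatible (e : rel X) tau c : Prop :=
  forall i j, e i j -> tau i != 0 -> tau j != 0 -> c i = c j.

Lemma aff_compatible_edge e tau c : aff_compatible e tau c ->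
  forall i j, e i j -> bracket (aff_point tau c i) (aff_point tau c j) = 0.
Proof.
move=> ce i j eij; rewrite aff_bracketE; apply: aff_eqP => //=.
have [->|ti] := eqVneq (tau i) 0; first by ring.
have [->|tj] := eqVneq (tau j) 0; first by ring.
by rewrite (ce _ _ eij ti tj); ring.
Qed.

(** The inner bracket is (0, tau_i tau_j (c_j - c_i)), and on vectors with first coordinate 0
    bracketing with the image of [p] is multiplication by [tau p]. *)
Lemma comm_word_aff tau c s i j :
  comm_word (aff_point tau c) (s, (i, j))
  = (0, monomial_val tau (multidegree (s, (i, j))) * (c j - c i)).
Proof.
rewrite monomial_val_multidegree /comm_word /=.
elim: s => [|p s IH] /=.
  by rewrite aff_bracketE big_nil; apply: aff_eqP => //=; ring.
by rewrite IH aff_bracketE big_cons; apply: aff_eqP => //=; ring.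
Qed.

End Affine.

(** * Separation of points by morphisms to [aff R] *)

Section Separation.
Variables (R : idomainType) (X : finType) (e : rel X).
Hypothesis natR_inj : injective (fun n : nat => n%:R : R).
Hypotheses (e_sym : symmetric e) (e_irr : irreflexive e).

Section Group.
Variables (s : seq (R * (seq X * (X * X)))).
Hypothesis s0 : forall tau c : X -> R, aff_compatible e tau c ->
  \sum_(l <- s) l.1 * (c l.2.2.2 - c l.2.2.1) * monomial_val tau (multidegree l.2) = 0.

Lemma multidegree_sum_eq0 (L : lieAlgType R) (f : X -> L) (k : {ffun X -> nat}) :
    metabelian L -> (forall i j, e i j -> bracket (f i) (f j) = 0) ->
  \sum_(l <- s | multidegree l.2 == k) l.1 *: comm_word f l.2 = 0.
Proof.
move=> Lmet f_edge.
have [/hasP|] := boolP (has (fun l => multidegree l.2 == k) s); last first.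
  by move/hasPn => sk; rewrite big1_seq // => l /andP [lk /sk]; rewrite lk.
move=> [[b0 [s1 [i0 j0]]] _ /= /eqP kE].
pose sigma := [:: i0, j0 & s1]; pose v := word_potential f sigma i0.
pose eS : rel X := fun p q => [&& e p q, p \in sigma & q \in sigma].
have eSC : connect_sym eS.
  by apply: sym_connect_sym => p q; rewrite /eS e_sym andbA andbAC -andbA.
(* For adjacent letters the difference is a commutator with inner bracket [p, q] = 0; irreflexivity
   makes [p] and [q] distinct, so both can be removed from [sigma]. *)
have v_eS p q : eS p q -> v p = v q.
  case/and3P => epq ps qs; apply/eqP; rewrite -subr_eq0; apply/eqP.
  have pq : q != p by apply: contraTneq epq => ->; rewrite e_irr.
  have qs' : q \in rem p sigma.
    by move: qs; rewrite (perm_mem (perm_to_rem ps)) inE (negPf pq).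
  rewrite -(@comm_word_potential _ _ _ _ Lmet sigma i0 (rem q (rem p sigma))).
  - by rewrite comm_word0 ?f_edge.
  - rewrite perm_sym (perm_trans (perm_to_rem ps)) // perm_cons.
    exact: perm_to_rem.
  - exact: mem_head.
have v_root p : v (fingraph.root eS p) = v p.
  have cl : closed eS [pred z | v z == v p] by move=> y z /v_eS /= yz; rewrite !inE yz.
  have := closed_connect cl (connect_root eS p); rewrite !inE eqxx => /esym.
  by move/eqP.
have v_sum i : v i = \sum_q (fingraph.root eS i == q)%:R *: v q.
  rewrite (bigD1 (fingraph.root eS i)) //= eqxx scale1r v_root big1 ?addr0 // => q.
  by rewrite eq_sym => /negPf ->; rewrite scale0r.
transitivity (\sum_(l <- s | multidegree l.2 == k) l.1 *: (v l.2.2.1 - v l.2.2.2)).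
  apply: eq_bigr => [[b [r [i j]]]] /= /eqP lk; congr (_ *: _).
  apply: comm_word_potential => //; last exact: mem_head.
  by apply: multidegree_eqP; rewrite lk kE.
transitivity (\sum_(l <- s | multidegree l.2 == k)
    \sum_q (l.1 * ((fingraph.root eS l.2.2.1 == q)%:R - (fingraph.root eS l.2.2.2 == q)%:R)) *: v q).
  apply: eq_bigr => l _; rewrite (v_sum l.2.2.1) (v_sum l.2.2.2) -sumrB scaler_sumr.
  by apply: eq_bigr => q _; rewrite -scalerBl scalerA.
rewrite exchange_big /= big1 // => q _; rewrite -scaler_suml.
rewrite [X in X *: _](_ : _ = 0) ?scale0r //.
(* Minus the indicator of the component of root [q], the sign matching [c j - c i] in [s0]. *)
pose c p : R := - (fingraph.root eS p == q)%:R.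
transitivity (\sum_(l <- s | multidegree l.2 == k) l.1 * (c l.2.2.2 - c l.2.2.1)).
  by apply: eq_bigr => l _; rewrite /c opprK addrC.
apply: (monomial_independence natR_inj).
(* Compatibility needs [tau] to vanish outside [sigma]: only then is every edge between vertices
   with nonzero [tau] an edge of [eS]. *)
move=> tau tauS; apply: s0 => i j eij ti tj; rewrite /c.
have in_sigma p : tau p != 0 -> p \in sigma.
  apply: contraNT => ps; apply/eqP/tauS; rewrite -kE ffunE.
  exact/count_memPn.
have /eqP -> // : fingraph.root eS i == fingraph.root eS j.
by rewrite root_connect // connect1 // /eS eij !in_sigma.
Qed.

End Group.

(* [M(X; G)] is residually the two-dimensional Lie algebra [aff R]. *)
Lemma pcm_aff_separation (t : fterm R X) :
  (forall tau c : X -> R, aff_compatible e tau c ->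
     fterm_eval (aff_point tau c) t = 0) ->
  pcm_class e t = 0.
Proof.
have [a [s nf]] := fterm_normal_form t; move=> t0.
have aff_nf (tau c : X -> R) : fterm_eval (aff_point tau c) t =
    (\sum_i a i * tau i,
     \sum_i a i * (tau i * c i)
     + \sum_(l <- s) l.1 * (c l.2.2.2 - c l.2.2.1) * monomial_val tau (multidegree l.2)).
  rewrite (nf _ _ (@aff_metabelian R)) !aff_sum; apply: aff_eqP => /=.
    rewrite [X in _ + X]big1 ?addr0 // => [[b [r [i j]]]] _ /=.
    by rewrite comm_word_aff /= scaler0.
  congr (_ + _); apply: eq_bigr => [[b [r [i j]]]] _ /=.
  by rewrite comm_word_aff /= /GRing.scale /=; ring.
(* With [c = 0] and [tau] the indicator of [i], the first coordinate reads off [a i]. *)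
have a0 i : a i = 0.
  have := t0 (fun j => (j == i)%:R) (fun=> 0) (fun _ _ _ _ _ => erefl).
  rewrite aff_nf => -[+ _]; rewrite (bigD1 i) //= eqxx mulr1 big1 ?addr0 // => j.
  by move/negPf->; rewrite mulr0.
have s0 (tau c : X -> R) : aff_compatible e tau c ->
  \sum_(l <- s) l.1 * (c l.2.2.2 - c l.2.2.1) * monomial_val tau (multidegree l.2) = 0.
  move=> /t0; rewrite aff_nf => -[_]; rewrite big1 ?add0r // => i _.
  by rewrite a0 mul0r.
rewrite pcm_classE (nf _ _ (@pcm_metabelian R X e)).
rewrite big1 ?add0r => [|i _]; last by rewrite a0 scale0r.
pose D := undup [seq multidegree l.2 | l <- s].
transitivity (\sum_(k <- D)
    \sum_(l <- s | multidegree l.2 == k) l.1 *: comm_word (pcm_gen e) l.2).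
  under [RHS]eq_bigr => k _ do rewrite big_mkcond.
  rewrite exchange_big /=; apply: eq_big_seq => l ls.
  rewrite (bigD1_seq (multidegree l.2)) ?undup_uniq //=; last first.
    by rewrite mem_undup; apply/mapP; exists l.
  by rewrite eqxx big1 ?addr0 // => k; rewrite eq_sym => /negPf ->.
rewrite big1 // => k _; apply: multidegree_sum_eq0 => //.
- exact: pcm_metabelian.
- exact: pcm_gen_edge.
Qed.

End Separation.

(** * Merging twin vertices *)

Lemma fterm_eval_poly (R : comNzRingType) (X : Type) (h : R -> X -> aff R)
    (t : fterm R X) :
  (forall i, exists P Q : {poly R}, forall r, h r i = (P.[r], Q.[r])) ->
  exists P Q : {poly R}, forall r, fterm_eval (h r) t = (P.[r], Q.[r]).
Proof.
move=> hP; elim: t => [i||s [P [Q IH]]|s [P [Q IH]] t [P' [Q' IH']]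
                      |a s [P [Q IH]]|s [P [Q IH]] t [P' [Q' IH']]] /=.
- exact: hP.
- by exists 0, 0 => r; rewrite !horner0.
- by exists (- P), (- Q) => r; rewrite IH !hornerN.
- by exists (P + P'), (Q + Q') => r; rewrite IH IH' !hornerD.
- by exists (a *: P), (a *: Q) => r; rewrite IH !hornerZ.
- exists 0, (P * Q' - P' * Q) => r.
  by rewrite IH IH' aff_bracketE !hornerE.
Qed.

Lemma poly_many_roots (R : idomainType) (P : {poly R}) (r : nat -> R) :
    injective r -> (forall N, exists2 n, (N <= n)%N & P.[r n] = 0) -> P = 0.
Proof.
move=> r_inj Pr; apply/eqP; apply: contraT => P0.
have [ns [sz un rts]] : exists ns : seq nat,
    [/\ size ns = size P, uniq ns & all (root P) (map r ns)].
  elim: (size P) => [|m [ns [sz un rts]]]; first by exists [::].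
  (* The new index exceeds all earlier ones, hence is distinct from them. *)
  have [n nN Pn] := Pr (\max_(k <- ns) k).+1.
  exists (n :: ns); rewrite /= sz un rts !andbT; split=> //; last exact/rootP.
  apply/negP => n_ns.
  by have := @leq_bigmax_seq _ ns xpredT id n n_ns isT; rewrite leqNgt nN.
have := max_poly_roots P0 rts; rewrite map_inj_uniq // => /(_ un).
by rewrite size_map sz ltnn.
Qed.

Lemma fterm_eval_many_roots (R : idomainType) (X : Type) (h : R -> X -> aff R)
    (t : fterm R X) (r : nat -> R) :
    (forall i, exists P Q : {poly R}, forall a, h a i = (P.[a], Q.[a])) ->
    injective r -> (forall N, exists2 n, (N <= n)%N & fterm_eval (h (r n)) t = 0) ->
  forall a, fterm_eval (h a) t = 0.
Proof.
move=> /(fterm_eval_poly t) [P [Q hPQ]] r_inj h0 a.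
have [P0 Q0] : P = 0 /\ Q = 0.
  by split; apply: (poly_many_roots r_inj) => N; have [n Nn] := h0 N;
     rewrite hPQ => -[Pn Qn]; exists n.
by rewrite hPQ P0 Q0 !horner0.
Qed.

Section Twins.
Variables (R : idomainType) (X : finType) (e : rel X) (x y : X).
Hypothesis natR_inj : injective (fun n : nat => n%:R : R).
Hypotheses (e_sym : symmetric e) (e_irr : irreflexive e).
Hypotheses (yx : y != x) (exy : e x y).
Hypothesis twin : forall z, z != x -> z != y -> e x z = e y z.

Local Notation e' := (del_vertex e x).
Local Notation M := (pcm_lie R e).
Local Notation M' := (pcm_lie R e').

(** [insub z] is [None] exactly at [z = x]. *)
Definition merge_gen (n : nat) (z : X) : M' :=
  if insub z is Some z' then pcm_gen e' z' else n%:R *: pcm_gen e' (Sub y yx).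

Definition merge (n : nat) : M -> M' := pcm_lift (merge_gen n).

Lemma merge_gen_val n z' : merge_gen n (val z') = pcm_gen e' z'.
Proof. by rewrite /merge_gen valK. Qed.

Lemma merge_gen_x n : merge_gen n x = n%:R *: pcm_gen e' (Sub y yx).
Proof. by rewrite /merge_gen insubF ?eqxx. Qed.

(** A neighbour of [x] is either [y], and [n y, y] = 0, or by [twin] a neighbour of [y]. *)
Lemma merge_gen_x_edge n z : e x z -> bracket (merge_gen n x) (merge_gen n z) = 0.
Proof.
move=> exz; have zx : z != x by apply: contraTneq exz => ->; rewrite e_irr.
rewrite merge_gen_x bracketZl -[z]/(val (Sub z zx : {z | z != x})) merge_gen_val.
have [zy|zy] := eqVneq z y; last first.
  by rewrite pcm_gen_edge ?scaler0 // /del_vertex /= -twin.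
suff -> : Sub z zx = Sub y yx :> {z | z != x} by rewrite bracketvv scaler0.
exact: val_inj.
Qed.

Lemma merge_gen_edge n i j : e i j -> bracket (merge_gen n i) (merge_gen n j) = 0.
Proof.
have [->|ix] := eqVneq i x; first exact: merge_gen_x_edge.
have [->|jx] := eqVneq j x.
  by rewrite e_sym bracketC => /merge_gen_x_edge ->; rewrite oppr0.
move=> eij; rewrite -[i]/(val (Sub i ix : {z | z != x})).
rewrite -[j]/(val (Sub j jx : {z | z != x})) !merge_gen_val.
exact: pcm_gen_edge.
Qed.

Lemma merge_morphism n : lie_morphism (merge n).
Proof. by apply: pcm_lift_morphism; [exact: pcm_metabelian|exact: merge_gen_edge]. Qed.

Lemma mergeE n t : merge n (pcm_class e t) = fterm_eval (merge_gen n) t.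
Proof. by apply: pcm_liftE; [exact: pcm_metabelian|exact: merge_gen_edge]. Qed.

Definition incl : M' -> M := pcm_lift (fun z' => pcm_gen e (val z')).

Lemma incl_edge z z' : e' z z' ->
  bracket (pcm_gen e (val z) : M) (pcm_gen e (val z')) = 0.
Proof. exact: (@pcm_gen_edge R X e). Qed.

Lemma incl_morphism : lie_morphism incl.
Proof. by apply: pcm_lift_morphism; [exact: pcm_metabelian|exact: incl_edge]. Qed.

Lemma incl_inj : injective incl.
Proof.
(* Every [merge n] fixes the generators other than [x] and so is a left inverse; [n = 0] is one
   choice. *)
apply: (can_inj (g := merge 0)) => u; have [t ->] := pcm_classP u.
rewrite /incl pcm_liftE; [|exact: pcm_metabelian|exact: incl_edge].
rewrite (fterm_eval_morphism (merge_morphism 0)) pcm_classE.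
by apply: fterm_eval_ext => z' /=; rewrite mergeE /= merge_gen_val.
Qed.

(** The image of [x] moves, with parameter [r], along the line spanned by (1, [c y]), which contains
    the image of [y]. *)
Definition twin_point (tau c : X -> R) (r : R) (z : X) : aff R :=
  if z == x then (r, r * c y) else aff_point tau c z.

Lemma twin_point_id tau c : aff_compatible e tau c -> tau y != 0 ->
  twin_point tau c (tau x) =1 aff_point tau c.
Proof.
move=> tc ty z; rewrite /twin_point; case: eqP => // ->.
have [tx|tx] := eqVneq (tau x) 0; first by rewrite /aff_point tx !mul0r.
by rewrite /aff_point (tc _ _ exy tx ty).
Qed.

(** At [r = n%:R * tau y] the evaluation factors as [merge n] followed by the morphism from [M']
    given by the points of the remaining vertices. *)
Lemma merge_twin_point n (t : fterm R X) tau c : aff_compatible e tau c ->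
  merge n (pcm_class e t) = 0 ->
  fterm_eval (twin_point tau c (n%:R * tau y)) t = 0.
Proof.
move=> tc tn; pose g (z : {z | z != x}) := aff_point tau c (val z).
have g_edge z z' : e' z z' -> bracket (g z) (g z') = 0.
  exact: (aff_compatible_edge tc).
have gM := pcm_lift_morphism (@aff_metabelian R) g_edge.
have := lie_morphism0 gM; rewrite -tn mergeE (fterm_eval_morphism gM) => <-.
apply: fterm_eval_ext => z; rewrite /twin_point /=; have [->|zx] := eqVneq z x.
  rewrite merge_gen_x (lie_morphismZ gM) pcm_lift_gen //; last exact: aff_metabelian.
  by apply: aff_eqP => //=; rewrite -mulrA.
rewrite -[z in merge_gen _ z]/(val (Sub z zx : {z | z != x})) merge_gen_val.
by rewrite pcm_lift_gen //; exact: aff_metabelian.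
Qed.

Lemma merge_kernel_aff (t : fterm R X) :
  (forall N, exists2 n, (N <= n)%N & merge n (pcm_class e t) = 0) ->
  forall tau c : X -> R, aff_compatible e tau c -> tau y != 0 ->
  fterm_eval (aff_point tau c) t = 0.
Proof.
move=> tM tau c tc ty; rewrite -(fterm_eval_ext t (twin_point_id tc ty)).
apply: (fterm_eval_many_roots (r := fun n => n%:R * tau y)).
- move=> i; rewrite /twin_point; case: eqP => _.
    by exists 'X, ('X * (c y)%:P) => r; rewrite !hornerE.
  by exists (tau i)%:P, (tau i * c i)%:P => r; rewrite !hornerC.
- by move=> m n /(mulIf ty) /natR_inj.
- by move=> N; have [n Nn tn] := tM N; exists n => //; exact: merge_twin_point.
Qed.

Lemma merge_kernel (u : M) :
  (forall N, exists2 n, (N <= n)%N & merge n u = 0) -> u = 0.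
Proof.
have [t ->] := pcm_classP u => tM.
apply: (pcm_aff_separation natR_inj e_sym e_irr) => tau c tc.
have [ty|] := eqVneq (tau y) 0; last exact: merge_kernel_aff.
have [tx|tx] := eqVneq (tau x) 0.
  (* Both twins go to 0, so the twin point at [n%:R * 0] is the given point and a single [n]
     suffices. *)
  have [n _ /(merge_twin_point tc) <-] := tM 0%N.
  apply: fterm_eval_ext => z; rewrite /twin_point ty mulr0 mul0r.
  by case: eqP => // ->; rewrite /aff_point tx mul0r.
(* Here [x] survives and [y] does not: moving the image of [y] along the line of
   [x] gives compatible points with [tau y != 0], as [x] and [y] are twins. *)
pose c' z : R := if z == y then c x else c z.
pose tau' r z : R := if z == y then r else tau z.
have -> : fterm_eval (aff_point tau c) t = fterm_eval (aff_point (tau' 0) c') t.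
  apply: fterm_eval_ext => z; rewrite /aff_point /tau' /c'.
  by case: eqP => // ->; rewrite ty !mul0r.
(* The parameters [n.+1%:R] avoid 0, so [merge_kernel_aff] applies at each of them; the value wanted
   is the one at 0. *)
apply: (fterm_eval_many_roots (h := fun r => aff_point (tau' r) c')
                              (r := fun n => n.+1%:R)).
- move=> i; rewrite /aff_point /tau'; case: eqP => _.
    by exists 'X, ('X * (c' i)%:P) => r; rewrite !hornerE.
  by exists (tau i)%:P, (tau i * c' i)%:P => r; rewrite !hornerC.
- by move=> m n /natR_inj [].
move=> N; exists N => //; apply: merge_kernel_aff => //; last first.
  by rewrite /tau' eqxx natr_eq0.
have cx z : e y z -> tau z != 0 -> c z = c x.
  have [->//|zx] := eqVneq z x; move=> eyz tz; apply/esym.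
  apply: (tc _ _ _ tx tz); rewrite twin //.
  by apply: contraTneq eyz => ->; rewrite e_irr.
move=> i j; rewrite /tau' /c'.
case: (eqVneq i y) => [->|_]; case: (eqVneq j y) => [->|_] //; last exact: tc.
  by move=> eyj _ /(cx _ eyj).
by rewrite e_sym => eyi /(cx _ eyi).
Qed.

(** A true equation survives every [merge n]; a false one stays false for large [n], since otherwise
    the difference of its sides is killed infinitely often and [merge_kernel] makes it 0.
    Connectives take the maximum of the thresholds. *)
Lemma merge_holds k (w : 'I_k -> M) (phi : qf_formula k) :
  exists N, forall n, (N <= n)%N -> holds (merge n \o w) phi <-> holds w phi.
Proof.
have binary (p q : qf_formula k) (op : Prop -> Prop -> Prop) :
    (forall A A' B B' : Prop, (A <-> A') -> (B <-> B') -> (op A B <-> op A' B')) ->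
    (exists N, forall n, (N <= n)%N -> holds (merge n \o w) p <-> holds w p) ->
    (exists N, forall n, (N <= n)%N -> holds (merge n \o w) q <-> holds w q) ->
    exists N, forall n, (N <= n)%N ->
      op (holds (merge n \o w) p) (holds (merge n \o w) q)
      <-> op (holds w p) (holds w q).
  move=> opP [N pN] [N' qN']; exists (maxn N N') => n.
  by rewrite geq_max => /andP [/pN ? /qN' ?]; exact: opP.
elim: phi => [s t|p [N IH]|p IHp q IHq|p IHp q IHq|p IHp q IHq] /=.
- have [st|st] := eqVneq (term_val w s) (term_val w t).
    exists 0%N => n _; split=> // _.
    by rewrite -!(term_val_morphism (merge_morphism n)) st.
  apply: contrapT => /forallNP noN; move/eqP: st; apply.
  apply/eqP; rewrite -subr_eq0; apply/eqP/merge_kernel => N.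
  have /existsNP [n /not_implyP [Nn H]] := noN N; exists n => //.
  rewrite (lie_morphismB (merge_morphism n)) !(term_val_morphism (merge_morphism n)).
  apply/eqP; rewrite subr_eq0; apply/eqP.
  by apply: contrapT => ne; apply: H; split=> // /(congr1 (merge n));
     rewrite !(term_val_morphism (merge_morphism n)).
- by exists N => n /IH; tauto.
- by apply: (binary _ _ and) IHp IHq; tauto.
- by apply: (binary _ _ or) IHp IHq; tauto.
- by apply: (binary _ _ (fun A B => A -> B)) IHp IHq; tauto.
Qed.

End Twins.

Theorem theorem4p7 (R : idomainType)
    (ZsubR : injective (fun n : int => (n%:~R)%R : R))
    (X : finType) (e : rel X)
    (e_sym : symmetric e) (e_irr : irreflexive e)
    (x : X) (x_class : (1 < #|perp_class e x|)%N) :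
  universally_equivalent (pcm_lie R e) (pcm_lie R (del_vertex e x)).
Proof.
have natR_inj : injective (fun n : nat => n%:R : R).
  by move=> m n mn; have [] := ZsubR (Posz m) (Posz n) mn.
have xx : x \in perp_class e x by rewrite inE /perp_equiv /=.
have /existsP [y /andP [yx]] : [exists y, (y != x) && (y \in perp_class e x)].
  move: x_class; rewrite (cardD1 x) xx ltnS => /card_gt0P [y].
  by rewrite inE /= => ?; apply/existsP; exists y.
rewrite inE /perp_equiv /= => /eqP pxy.
(* Twins are adjacent: [y] lies in [perp y], which equals [perp x], and [y != x]. *)
have exy : e x y.
  by have := in_perp e x y; rewrite pxy !in_perp eqxx (negPf yx) => /esym.
have twin z : z != x -> z != y -> e x z = e y z.
  move=> zx zy; have := in_perp e x z.
  by rewrite pxy in_perp (negPf zx) (negPf zy).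
move=> k phi; split=> [phiM w|phiM' w].
  have iM := incl_morphism R e x.
  by apply/(holds_inj_morphism iM w phi); [exact: (incl_inj e_sym e_irr yx twin)|exact: phiM].
(* The retraction is chosen after [w] and [phi]; it carries the assignment to one in [M(X'; G')]
   with the same truth value. *)
have [N /(_ N (leqnn N)) <-] := merge_holds natR_inj e_sym e_irr yx exy twin w phi.
exact: phiM'.
Qed.
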